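(* Let $\Gamma$ be a countable infinite group and let $f$ be a free p.m.p. action of $\Gamma$. Then $f$ weakly contains every Bernoulli action $\kappa^{\Gamma}$ of $\Gamma$ (for every standard probability space $\kappa$). In particular, any two free p.m.p. actions of $\Gamma$ that are factors of i.i.d. are weakly equivalent.
   Context: A p.m.p. (probability measure preserving) action $f$ of a countable group $\Gamma$ on a standard Borel probability space $(X,\mathcal{B},\mu)$ assigns to each $\gamma\in\Gamma$ a measure preserving Borel transformation $f_\gamma$ of $X$, with $f_{\gamma\delta}=f_\gamma f_\delta$. The action $f$ is free if for $\mu$-almost every $x\in X$ and all $\gamma\neq\gamma'\in\Gamma$ we have $f_\gamma(x)\neq f_{\gamma'}(x)$. Weak containment: let $f$ and $g$ be p.m.p. actions of $\Gamma$ on $(X,\mathcal{B},\mu)$ and $(Y,\mathcal{C},\nu)$. Then $f$ weakly contains $g$ if for all Borel subsets $Y_1,\ldots,Y_n\in\mathcal{C}$, every finite set $S\subseteq\Gamma$ and every $\varepsilon>0$ there exist Borel subsets $X_1,\ldots,X_n\in\mathcal{B}$ such that $$\left|\mu(f_\gamma X_i\cap X_j)-\nu(g_\gamma Y_i\cap Y_j)\right|<\varepsilon\quad(1\le i,j\le n,\ \gamma\in S).$$ The actions $f$ and $g$ are weakly equivalent if each weakly contains the other. For a (standard) probability space $\kappa$, the Bernoulli action $\kappa^{\Gamma}$ is the set of maps from $\Gamma$ to $\kappa$ with the product measure and the shift action of $\Gamma$, $(\delta\cdot\omega)(\gamma)=\omega(\gamma\delta)$; it is also called an i.i.d. process on $\Gamma$.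 A p.m.p. action $g$ on $(Y,\mathcal{C},\nu)$ is a factor of $f$ on $(X,\mathcal{B},\mu)$ if there is a surjective measure preserving $\Gamma$-equivariant map from $X$ to $Y$ (everything understood up to null sets). A free factor of i.i.d. is a free p.m.p. action that is a factor of some Bernoulli action of $\Gamma$. *)

(* Defs.v *)
From HB Require Import structures.
From mathcomp Require Import all_boot all_order all_algebra.
From mathcomp Require Import all_classical all_reals all_analysis.

Set Implicit Arguments.
Unset Strict Implicit.
Unset Printing Implicit Defensive.

Import Order.TTheory GRing.Theory Num.Theory.

Local Open Scope classical_set_scope.
Local Open Scope ring_scope.

(* [T] is isomorphic to the Borel space of a Polish space; the Hausdorff
   condition turns the pseudometric of the library into a metric. *)
Definition standard_borel (R : realType) (d : measure_display)
    (T : measurableType d) : Prop :=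
  exists (P : completePseudoMetricType R) (h : T -> P),
    [/\ hausdorff_space P,
        exists2 D : set P, countable D & dense D,
        bijective h
      & forall A : set T, measurable A <-> <<s @open P >> (h @` A)].

(* Each [f g] is invertible with measurable inverse [f g^-1], so that forward
   images of measurable sets are measurable. *)
Record pmp_action (R : realType) (G : groupType) (d : measure_display)
    (X : measurableType d) (mu : probability X R) (f : G -> X -> X) : Prop := {
  pmp_standard : standard_borel R X;
  pmp_act1 : forall x, f 1%g x = x;
  pmp_actM : forall (g h : G) x, f (g * h)%g x = f g (f h x);
  pmp_measurable : forall g, measurable_fun [set: X] (f g);
  pmp_preserving : forall g (A : set X),
    measurable A -> mu (f g @^-1` A) = mu A
}.

Definition free_action (R : realType) (G : groupType) (d : measure_display)
    (X : measurableType d) (mu : probability X R) (f : G -> X -> X) : Prop :=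
  {ae mu, forall x, forall g h : G, g <> h -> f g x <> f h x}.

Definition weakly_contains (R : realType) (G : groupType)
    (d1 : measure_display) (X : measurableType d1) (mu : probability X R)
    (f : G -> X -> X)
    (d2 : measure_display) (Y : measurableType d2) (nu : probability Y R)
    (g : G -> Y -> Y) : Prop :=
  forall (n : nat) (B : 'I_n -> set Y), (forall i, measurable (B i)) ->
  forall S : set G, finite_set S ->
  forall e : R, 0 < e ->
  exists2 A : 'I_n -> set X, forall i, measurable (A i) &
    forall (i j : 'I_n) (c : G), S c ->
      `| fine (mu (f c @` A i `&` A j)) - fine (nu (g c @` B i `&` B j)) | < e.

Definition weakly_equivalent (R : realType) (G : groupType)
    (d1 : measure_display) (X : measurableType d1) (mu : probability X R)
    (f : G -> X -> X)
    (d2 : measure_display) (Y : measurableType d2) (nu : probability Y R)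
    (g : G -> Y -> Y) : Prop :=
  weakly_contains mu f nu g /\ weakly_contains nu g mu f.

Definition coordinate_sets (G : Type) (d : measure_display)
    (K : measurableType d) : set (set (G -> K)) :=
  [set C | exists c : G, exists2 A : set K, measurable A &
             C = [set w | A (w c)]].

(* [G -> K] with the product sigma-algebra *)
Notation prod_space G K := (g_sigma_algebraType (@coordinate_sets G _ K)).

(* The product measure on [G -> K] with all factors equal to [kappa] is the
   (unique) probability [P] satisfying this predicate. *)
Definition product_measure (R : realType) (G : groupType)
    (d : measure_display) (K : measurableType d) (kappa : probability K R)
    (P : probability (prod_space G K) R) : Prop :=
  forall (J : seq G) (A : G -> set K), uniq J ->
    (forall c, measurable (A c)) ->
    P [set w | forall c, c \in J -> A c (w c)]
      = (\prod_(c <- J) kappa (A c))%E.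

Definition bernoulli_shift (G : groupType) (K : Type) (c : G) (w : G -> K) : G -> K :=
  fun b => w (b * c)%g.

(* [(Y, nu, g)] is a factor of [(X, mu, f)], all conditions up to null sets *)
Definition factor_of (R : realType) (G : groupType)
    (d2 : measure_display) (Y : measurableType d2) (nu : probability Y R)
    (g : G -> Y -> Y)
    (d1 : measure_display) (X : measurableType d1) (mu : probability X R)
    (f : G -> X -> X) : Prop :=
  exists phi : X -> Y,
    [/\ measurable_fun [set: X] phi,
        forall B : set Y, measurable B -> mu (phi @^-1` B) = nu B,
        forall c : G, {ae mu, forall x, phi (f c x) = g c (phi x)}
      & nu.-negligible (~` range phi)].

Definition factor_of_iid (R : realType) (G : groupType)
    (d : measure_display) (Y : measurableType d) (nu : probability Y R)
    (g : G -> Y -> Y) : Prop :=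
  exists (d' : measure_display) (K : measurableType d')
         (kappa : probability K R) (P : probability (prod_space G K) R),
    [/\ standard_borel R K, product_measure kappa P
      & factor_of nu g P (@bernoulli_shift G K)].

(* Main.v *)
Require Import Defs.
From mathcomp Require Import all_boot all_order all_algebra.
From mathcomp Require Import all_classical all_reals all_analysis.
From mathcomp Require Import ring lra.

(* Cut [X] into finitely many cells by a finite part of a separating sequence
   of measurable sets, give the cells distinct names in [G], and label the cell
   named [g] by the coordinate [w g] of a [P]-random [w : G -> K]. Reading the
   labels along the orbit of [x] defines an equivariant map [X -> (G -> K)].
   By freeness, for a fine partition a finite piece of the orbit of most points
   meets pairwise distinct cells, and since [mu] has no atoms the pieces of the
   orbits of two independent points mostly meet disjoint sets of cells. Hence,
   for an event [E] depending on finitely many coordinates, the [mu]-measure of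
   the preimage of [E] has mean close to [P E] and small variance in [w], so
   some [w] is good for finitely many such events at once. Approximating the
   given sets by such events gives the weak containment of the Bernoulli shift;
   a factor of the shift is then handled by pulling sets back to it. *)

Set Implicit Arguments.
Unset Strict Implicit.
Unset Printing Implicit Defensive.

Import Order.TTheory GRing.Theory Num.Theory.

Local Open Scope classical_set_scope.
Local Open Scope ring_scope.

(** * Means of integrable functions *)

Section has_mean.
Context (R : realType) (d : measure_display) (T : measurableType d).
Variable P : probability T R.
Implicit Types (g h : T -> R) (u v : R).

(** Integrability and a real value are bundled, so that moment computations take place in [R] rather
    than in the extended reals. *)
Definition has_mean g v :=
  P.-integrable setT (EFin \o g) /\ (\int[P]_x (g x)%:E = v%:E)%E.

Lemma fine_probability (A : set T) : measurable A -> (fine (P A))%:E = P A.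
Proof. by move=> mA; rewrite fineK ?fin_num_measure. Qed.

Lemma fine_probability_le1 (A : set T) : measurable A -> fine (P A) <= 1.
Proof. by move=> mA; rewrite -lee_fin fine_probability// probability_le1. Qed.

Lemma fine_probability_ge0 (A : set T) : 0 <= fine (P A).
Proof. by rewrite fine_ge0. Qed.

Lemma le_fine_probability (A B : set T) : measurable A -> measurable B ->
  A `<=` B -> fine (P A) <= fine (P B).
Proof.
move=> mA mB AB; rewrite -lee_fin !fine_probability//.
by rewrite le_measure// inE.
Qed.

Lemma has_mean_indic (A : set T) :
  measurable A -> has_mean (\1_A) (fine (P A)).
Proof.
move=> mA; split; first exact: (integrable_indic P mA).
by rewrite integral_indic// setIT fine_probability.
Qed.

Lemma has_meanD g h u v :
  has_mean g u -> has_mean h v -> has_mean (fun x => g x + h x) (u + v).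
Proof.
move=> [ig eg] [ih eh]; split.
  by under [X in _.-integrable _ X]eq_fun do rewrite /= EFinD; exact: integrableD.
by under eq_integral do rewrite EFinD; rewrite integralD// eg eh.
Qed.

Lemma has_meanZ a g u : has_mean g u -> has_mean (fun x => a * g x) (a * u).
Proof.
move=> [ig eg]; split.
  by under [X in _.-integrable _ X]eq_fun do rewrite /= EFinM; exact: integrableZl.
by under eq_integral do rewrite EFinM; rewrite integralZl// eg.
Qed.

Lemma has_mean_cst a : has_mean (fun=> a) a.
Proof.
have := has_meanZ a (has_mean_indic measurableT).
rewrite probability_setT mulr1; congr (has_mean _ _).
by apply/funext => x; rewrite indicT mulr1.
Qed.

Lemma has_mean_sum (I : Type) (s : seq I) (g : I -> T -> R) (u : I -> R) :
  (forall i, has_mean (g i) (u i)) ->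
  has_mean (fun x => \sum_(i <- s) g i x) (\sum_(i <- s) u i).
Proof.
move=> gu; elim: s => [|i s IH].
  by under eq_fun do rewrite big_nil; rewrite big_nil; exact: has_mean_cst.
by under eq_fun do rewrite big_cons; rewrite big_cons; exact: has_meanD.
Qed.

Lemma has_mean_le g h u v : has_mean g u -> has_mean h v ->
  (forall x, g x <= h x) -> u <= v.
Proof.
move=> [ig eg] [ih eh] gh; rewrite -lee_fin -eg -eh.
by apply: le_integral => // x _; rewrite lee_fin.
Qed.

Lemma has_mean_unique g u v : has_mean g u -> has_mean g v -> u = v.
Proof. by move=> [_ e1] [_]; rewrite e1 => -[]. Qed.

(** First moment method: a function that is everywhere at least [a] has mean at least [a]. The final
    choice of the labels [w] rests on it. *)
Lemma has_mean_exists_lt g u a : has_mean g u -> u < a -> exists x, g x < a.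
Proof.
move=> gu ua; apply: contrapT => /forallNP h.
suff : a <= u by rewrite leNgt ua.
apply: has_mean_le (has_mean_cst a) gu _ => x.
by rewrite leNgt; apply/negP/h.
Qed.

End has_mean.

(** * Separating sequences and free actions *)

Lemma infinite_set_injection (T : Type) :
  infinite_set [set: T] -> exists e : nat -> T, injective e.
Proof.
move=> /infiniteP/card_leP/unsquash e0.
exists (fun k => val (e0 (SigSub (in_setT k)))) => i j /val_inj/inj.
by rewrite !inE => /(_ I I)[].
Qed.

(** The sets are preimages of balls of radius [1/(n+1)] about the points of a countable dense set,
    numbered by the code of the centre and [n]. Interiors are taken because [ball] itself is not
    assumed open. *)
Lemma standard_borel_separating (R : realType) (d : measure_display)
    (T : measurableType d) : standard_borel R T ->
  exists U : nat -> set T, (forall k, measurable (U k)) /\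
    forall x y, x <> y -> exists k, U k x /\ ~ U k y.
Proof.
move=> [P [h [hP [D cD dD] [h' hK h'K] mT]]].
have [i inj_i] : exists i : P -> nat, {in D &, injective i}.
  exact/countable_injP.
(* [i] is injective on [D], so at most one centre has code [k.1] and the union has at most one
   term. *)
pose O (k : nat * nat) : set P :=
  \bigcup_(a in [set a | D a /\ i a = k.1]) (ball a (k.2.+1%:R^-1 : R))°.
have oO k : open (O k) by apply: bigcup_open => a _; exact: open_interior.
exists (fun n => if unpickle n is Some k then h @^-1` O k else set0).
split=> [n|x y xy].
  case: unpickle => [k|]; last exact: measurable0.
  apply/mT; rewrite image_preimage; first exact: sub_sigma_algebra.
  by apply/seteqP; split=> // p _; exists (h' p).
have hxy : h x != h y by apply/eqP => /(can_inj hK).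
move: hP; rewrite ball_hausdorff => /(_ _ _ hxy)[[r1 r2] /= /eqP r12].
pose n := Num.truncn ((Num.min r1%:num r2%:num)^-1).
have n_gt0 : 0 < n.+1%:R^-1 :> R by rewrite invr_gt0.
have nr : n.+1%:R^-1 <= Num.min r1%:num r2%:num.
  rewrite -[leRHS]invrK lef_pV2 ?posrE ?invr_gt0 ?lt_min //=.
    by apply/ltW; rewrite /n Num.Theory.truncnS_gt.
  by rewrite !gt0.
have [nr1 nr2] : n.+1%:R^-1 <= r1%:num /\ n.+1%:R^-1 <= r2%:num :> R.
  by move: nr; rewrite le_min => /andP.
(* If the centre [a] is within half the radius of [h x], its ball contains a neighbourhood of [h x].
   Were [h y] in that ball too, [a] would lie in both of the disjoint balls about [h x] and
   [h y]. *)
pose e := n.+1%:R^-1 / 2 : R.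
have e_gt0 : 0 < e by rewrite divr_gt0.
have [a [xa Da]] : ((ball (h x) e)° `&` D) !=set0.
  apply: dD; last exact: open_interior.
  by exists (h x); apply: nbhsx_ballx.
have bxa : ball (h x) e a by exact: interior_subset xa.
have bO p : O (i a, n) p -> (ball a n.+1%:R^-1)° p.
  move=> [b [Db /= iba] bp].
  by rewrite -(inj_i b a) // inE.
exists (pickle (i a, n)); rewrite pickleK; split.
  exists a => //=.
  have : nbhs (h x) (ball (h x) e) by exact: nbhsx_ballx.
  apply: filterS => p xp; have -> : n.+1%:R^-1 = e + e :> R.
    by rewrite /e -splitr.
  by apply: ball_triangle xp; exact: ball_sym.
move=> /bO/interior_subset ay.
suff : (ball (h x) r1%:num `&` ball (h y) r2%:num) a by rewrite r12.
split.
  apply: le_ball bxa; apply: le_trans nr1.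
  by rewrite /e ler_pdivrMr// ler_peMr ?ler1n// ltW.
by apply: (le_ball nr2); exact: ball_sym.
Qed.

Section finite_code.
Context (d : measure_display) (X : measurableType d).

(** Codes take values in plain finite types, so their measurability is expressed through fibres
    throughout. *)
Lemma measurable_finite_preimage (I : finType) (c : X -> I) (Q : set I) :
  (forall i, measurable [set x | c x = i]) -> measurable [set x | Q (c x)].
Proof.
move=> mc; have -> : [set x | Q (c x)] =
    \bigcup_(i in Q) [set x | c x = i].
  by apply/seteqP; split=> [x Qx|x [i Qi /= ->]//]; exists (c x).
by apply: fin_bigcup_measurable => //; exact: finite_finset.
Qed.

Lemma measurable_finite_preimage2 (I J : finType) (a : X -> I) (b : X -> J)
    (Q : I -> J -> Prop) :
  (forall i, measurable [set x | a x = i]) ->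
  (forall j, measurable [set x | b x = j]) ->
  measurable [set x | Q (a x) (b x)].
Proof.
move=> ma mb.
apply: (@measurable_finite_preimage _ (fun x => (a x, b x)) (fun p => Q p.1 p.2)).
move=> [i j]; rewrite [X in measurable X](_ : _ =
    [set x | a x = i] `&` [set x | b x = j]); first exact: measurableI.
by apply/seteqP; split=> x /= => [[-> ->]//|[-> ->]].
Qed.

Lemma measurable_ffun_code (I J : finType) (a : I -> X -> J) (t : {ffun I -> J}) :
  (forall i j, measurable [set x | a i x = j]) ->
  measurable [set x | [ffun i => a i x] = t].
Proof.
move=> ma; rewrite [X in measurable X](_ : _ =
    \bigcap_(i in setT) [set x | a i x = t i]).
  by apply: fin_bigcap_measurable => //; exact: finite_finset.
apply/seteqP; split=> [x /= <- i _|x h] /=; first by rewrite ffunE.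
by apply/ffunP => i; rewrite ffunE h.
Qed.

End finite_code.

Lemma decreasing_measure_lt (R : realType) (d : measure_display)
    (X : measurableType d) (mu : probability X R) (F : nat -> set X) :
  (forall m, measurable (F m)) -> (forall m n, (m <= n)%N -> F n `<=` F m) ->
  mu (\bigcap_n F n) = 0%E -> forall e, 0 < e ->
  exists M, forall m, (M <= m)%N -> fine (mu (F m)) < e.
Proof.
move=> mF dF F0 e e0.
have : (mu \o F) x @[x --> \oo] --> mu (\bigcap_n F n).
  apply: nonincreasing_cvg_mu => //.
  - by rewrite (le_lt_trans (probability_le1 _ _))// ltry.
  - exact: bigcapT_measurable.
  - by move=> m n mn; apply/subsetPset/dF.
rewrite F0 => /fine_cvgP[_ /cvgrPdist_lt /(_ _ e0)[M _ hM]].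
exists M => m /hM /=; rewrite sub0r normrN; apply: le_lt_trans.
exact: ler_norm.
Qed.

(** * Finite partitions generated by a separating sequence *)

Section bits.
Context (R : realType) (d : measure_display) (X : measurableType d).
Variables (mu : probability X R) (U : nat -> set X).
Hypotheses (mU : forall k, measurable (U k))
  (sepU : forall x y, x <> y -> exists k, U k x /\ ~ U k y).

Definition bits m (x : X) : {ffun 'I_m -> bool} := [ffun k => `[< U (val k) x >]].

Lemma measurable_bits m t : measurable [set x | bits m x = t].
Proof.
apply: (@measurable_ffun_code _ _ _ _ (fun k : 'I_m => fun x => `[< U (val k) x >])).
move=> k [].
  by rewrite [X in measurable X](_ : _ = U k)//; apply/seteqP; split=> x /asboolP.
rewrite [X in measurable X](_ : _ = ~` U k); first exact: measurableC.
by apply/seteqP; split=> x /= => [|nU]; [move/asboolP | apply/asboolP].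
Qed.

Lemma measurable_bits_comp (g : X -> X) m t :
  measurable_fun setT g -> measurable [set x | bits m (g x) = t].
Proof.
by move=> mg; have := mg measurableT _ (@measurable_bits m t); rewrite setTI.
Qed.

Lemma bits_le m n x y : (m <= n)%N -> bits n x = bits n y -> bits m x = bits m y.
Proof.
move=> mn /ffunP xy; apply/ffunP => k.
by have := xy (widen_ord mn k); rewrite !ffunE.
Qed.

Lemma bits_inj x y : (forall m, bits m x = bits m y) -> x = y.
Proof.
move=> xy; apply: contrapT => /sepU[k [Ukx Uky]].
have /ffunP/(_ ord_max) := xy k.+1; rewrite !ffunE /=.
by move=> /(congr1 is_true); rewrite !asboolE => e; apply: Uky; rewrite -e.
Qed.

Lemma measurable_singleton (x : X) : measurable [set x].
Proof.
rewrite [X in measurable X](_ : _ = \bigcap_m [set y | bits m y = bits m x]).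
  by apply: bigcapT_measurable => m; exact: measurable_bits.
apply/seteqP; split=> [y -> //|y h].
by apply: bits_inj => m; exact: h.
Qed.

(** The cells around a point shrink to that point, but at a rate depending on it. To get a uniform
    bound, let [Z m] be the union of the cells of measure at least [e]: these sets decrease to the
    empty set, so eventually [Z m] has measure below [e], and then it cannot contain even one such
    cell. *)
Lemma bits_cells_lt e : (forall x, mu [set x] = 0%E) -> 0 < e ->
  exists M, forall m, (M <= m)%N ->
    forall t, fine (mu [set x | bits m x = t]) < e.
Proof.
move=> mu1 e0.
pose cell m x := [set y | bits m y = bits m x].
have mcell m x : measurable (cell m x) by exact: measurable_bits.
have dcell x m n : (m <= n)%N -> cell n x `<=` cell m x.
  by move=> mn y; exact: bits_le.
pose Z m := [set x | e <= fine (mu (cell m x))].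
have mZ m : measurable (Z m).
  apply: (@measurable_finite_preimage _ _ _ (bits m)
    [set t | e <= fine (mu [set y | bits m y = t])]).
  exact: measurable_bits.
have [] := @decreasing_measure_lt _ _ _ mu Z mZ _ _ e e0.
- move=> m n mn x /= /le_trans; apply.
  by apply: le_fine_probability => //; exact: dcell.
- rewrite [X in mu X](_ : _ = set0) ?measure0//.
  apply/seteqP; split=> [x Zx|//].
  have [] := @decreasing_measure_lt _ _ _ mu (cell^~ x) _ _ _ e e0 => //.
  + by move=> m n; exact: dcell.
  + rewrite [X in mu X](_ : _ = [set x])//.
    apply/seteqP; split=> [y h|y -> //].
    by apply: bits_inj => m; exact: h.
  + by move=> M /(_ _ (leqnn M)); rewrite ltNge Zx.
move=> M hM; exists M => m /hM Zm t; rewrite ltNge; apply/negP => et.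
have [x xt] : exists x, bits m x = t.
  apply/not_existsP => h; move: et; rewrite [X in mu X](_ : _ = set0).
    by rewrite measure0 leNgt e0.
  by apply/seteqP; split=> // x /h.
move: Zm; rewrite ltNge; case/negP.
apply: (le_trans et); apply: le_fine_probability => //.
  exact: measurable_bits.
by move=> y yt; rewrite /Z /= /cell yt.
Qed.

(** The collision sets decrease to the null set where [f x = g x], since points with the same bits
    at every level are equal. *)
Lemma bits_collision_lt (f g : X -> X) e :
  measurable_fun setT f -> measurable_fun setT g ->
  mu.-negligible [set x | f x = g x] -> 0 < e ->
  exists M, forall m, (M <= m)%N ->
    fine (mu [set x | bits m (f x) = bits m (g x)]) < e.
Proof.
move=> mf mg fg0 e0; apply: decreasing_measure_lt => //.
- move=> m; apply: (@measurable_finite_preimage2 _ _ _ _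
    (bits m \o f) (bits m \o g) (fun s t => s = t)) => t /=;
  exact: measurable_bits_comp.
- by move=> m n mn x /=; exact: bits_le.
apply: measure_negligible.
  apply: bigcapT_measurable => m; apply: (@measurable_finite_preimage2 _ _ _ _
    (bits m \o f) (bits m \o g) (fun s t => s = t)) => t /=;
  exact: measurable_bits_comp.
apply: negligibleS fg0 => x h /=; apply: bits_inj => m; exact: h.
Qed.

End bits.

(** * Inverses, freeness and absence of atoms *)

Section action.
Context (R : realType) (G : groupType) (d : measure_display)
  (X : measurableType d).
Variables (mu : probability X R) (f : G -> X -> X).
Hypothesis fP : pmp_action mu f.

Lemma act_invK g : cancel (f g) (f g^-1%g).
Proof. by move=> x; rewrite -(pmp_actM fP) mulVg (pmp_act1 fP). Qed.

Lemma act_Kinv g : cancel (f g^-1%g) (f g).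
Proof. by move=> x; rewrite -(pmp_actM fP) mulgV (pmp_act1 fP). Qed.

Lemma act_image g A : f g @` A = f g^-1%g @^-1` A.
Proof.
apply/seteqP; split=> [_ [x Ax <-]|x Ax]; first by rewrite /= act_invK.
by exists (f g^-1%g x) => //; exact: act_Kinv.
Qed.

Lemma measurable_act_preimage g A : measurable A -> measurable (f g @^-1` A).
Proof.
by move=> mA; have := pmp_measurable fP g measurableT mA; rewrite setTI.
Qed.

Hypotheses (ffree : free_action mu f) (Ginf : infinite_set [set: G]).

Lemma free_action_collision g h : g <> h ->
  mu.-negligible [set x | f g x = f h x].
Proof.
by move=> gh; apply: negligibleS ffree => x /= e fr; exact: (fr _ _ gh e).
Qed.

(** A point of positive mass lies outside every null set, so freeness holds at it. Its orbit is then
    infinite, all orbit points have the same mass, and finitely many of them exceed total mass 1. *)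
Lemma free_action_atomless x : mu [set x] = 0%E.
Proof.
have [U [mU sepU]] := standard_borel_separating (pmp_standard fP).
have m1 := measurable_singleton mU sepU.
apply: contrapT => mux.
have frx g h : g <> h -> f g x <> f h x.
  move=> gh e; apply: mux; apply: measure_negligible => //.
  by apply: negligibleS (free_action_collision gh) => _ ->.
have [e inj_e] := infinite_set_injection Ginf.
have mu_orbit g : mu [set f g x] = mu [set x].
  rewrite -(pmp_preserving fP g (m1 _)); congr (mu _).
  apply/seteqP; split=> [y /= /(can_inj (act_invK g)) //|y -> //].
pose E n := [set y | exists2 k : nat, (k < n)%N & y = f (e k) x].
have ES n : E n.+1 = E n `|` [set f (e n) x].
  apply/seteqP; split=> [y [k]|y [[k kn ->]|->]].
  - by rewrite ltnS leq_eqVlt => /predU1P[-> ->|kn ->]; [right|left; exists k].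
  - by exists k => //; exact: ltnW.
  - by exists n.
have mE n : measurable (E n).
  elim: n => [|n IH]; last by rewrite ES; exact: measurableU.
  by rewrite [E 0%N](_ : _ = set0)//; apply/seteqP; split=> [y []|].
have muE n : fine (mu (E n)) = fine (mu [set x]) *+ n.
  elim: n => [|n IH].
    by rewrite [E 0%N](_ : _ = set0) ?measure0//; apply/seteqP; split=> [y []|].
  have -> : (mu (E n.+1) = mu (E n) + mu [set x])%E; last first.
    by rewrite fineD ?fin_num_measure// IH mulrSr.
  rewrite -(mu_orbit (e n)) ES measureU//.
  apply/seteqP; split=> // y [[k kn ->] /= /esym].
  apply: frx => /inj_e nk.
  by rewrite nk ltnn in kn.
have a0 : 0 < fine (mu [set x]).
  rewrite lt_neqAle fine_probability_ge0 andbT eq_sym; apply/eqP => a0.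
  by apply: mux; rewrite -fine_probability// a0.
pose n := (Num.truncn (fine (mu [set x]))^-1).+1.
have := fine_probability_le1 mu (mE n).
rewrite muE leNgt => /negP; apply.
by rewrite -mulr_natr -ltr_pdivrMl// mulr1 Num.Theory.truncnS_gt.
Qed.

End action.

(** * Product measures and boxes *)

Lemma measurableY (d : measure_display) (T : measurableType d) (A B : set T) :
  measurable A -> measurable B -> measurable (A `+` B).
Proof. by move=> mA mB; apply: measurableU; exact: measurableD. Qed.

(** * Approximation of measurable sets by a generating algebra *)

Section approximation.
Context (R : realType) (T : pointedType) (C : set (set T)).
Local Notation Om := (g_sigma_algebraType C).
Variables (P : probability Om R) (N : set (set Om)).
Hypotheses (N_measurable : forall A, N A -> measurable A) (CN : C `<=` N)
  (N0 : N set0) (NC : forall A, N A -> N (~` A))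
  (NU : forall A B, N A -> N B -> N (A `|` B)).

(** The approximable sets form a sigma-algebra containing the generators. For a countable union,
    continuity from above reduces to a finite union, which is approximated term by term. *)
Lemma algebra_approximation (B : set Om) : measurable B ->
  forall e, 0 < e -> exists2 B', N B' & fine (P (B `+` B')) < e.
Proof.
move=> mB.
pose approx (B : set Om) := measurable B /\
  forall e, 0 < e -> exists2 B', N B' & fine (P (B `+` B')) < e.
suff : approx B by case.
have approxU (F : nat -> set Om) : (forall k, approx (F k)) -> approx (\bigcup_k F k).
  move=> hF.
  have mF k : measurable (F k) by have [] := hF k.
  have mUF : measurable (\bigcup_k F k) by exact: bigcupT_measurable.
  split=> // e e0.
  pose E n := \bigcup_k F k `\` \bigcup_(k in `I_n) F k.
  have mE n : measurable (E n).
    by apply: measurableD => //; apply: bigcup_measurable.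
  have [] := @decreasing_measure_lt _ _ _ P E mE _ _ (e / 2) (divr_gt0 e0 _) => //.
  - move=> m n mn x [Fx nFx]; split=> // -[k /= km Fkx]; apply: nFx.
    by exists k => //=; exact: leq_trans mn.
  - rewrite [X in P X](_ : _ = set0) ?measure0//; apply/seteqP; split=> // x h.
    have [[k _ Fkx] _] := h 0%N I.
    by have [_] := h k.+1 I; apply; exists k => /=.
  move=> n /(_ n (leqnn n)) En.
  (* The bound [e'] is general in the induction, because each further set of the union costs half of
     it. *)
  have : forall e', 0 < e' -> exists2 B', N B' &
      fine (P ((\bigcup_(k in `I_n) F k) `+` B')) < e'.
    elim: n {En} => [|n IH] e' e'0.
      by rewrite II0 bigcup_set0; exists set0 => //; rewrite setYK measure0.
    have [B1 NB1 h1] := IH _ (divr_gt0 e'0 (ltr0n _ 2)).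
    have [B2 NB2 h2] := (hF n).2 _ (divr_gt0 e'0 (ltr0n _ 2)).
    exists (B1 `|` B2); first exact: NU.
    have -> : \bigcup_(k in `I_n.+1) F k = \bigcup_(k in `I_n) F k `|` F n.
      by rewrite IIS bigcup_setU bigcup_set1.
    set D := \bigcup_(k in _) _.
    have mD : measurable D by exact: bigcup_measurable.
    have mB1 := N_measurable NB1; have mB2 := N_measurable NB2.
    rewrite [e']splitr; apply: le_lt_trans (ltrD h1 h2).
    have mFn := mF n.
    have m1 : measurable (D `|` F n) by exact: measurableU.
    have m2 : measurable (B1 `|` B2) by exact: measurableU.
    have [m3 m4 m5] := And3 (measurableY m1 m2) (measurableY mD mB1) (measurableY mFn mB2).
    rewrite -lee_fin EFinD !fine_probability//.
    apply: le_trans (measureU2 _ _ _) => //.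
    apply: le_measure; rewrite ?inE//; first exact: measurableU.
    by move=> x; rewrite /setY /setD /setU /=; tauto.
  move=> /(_ _ (divr_gt0 e0 (ltr0n _ 2)))[B' NB' hB']; exists B' => //.
  set D := \bigcup_(k in `I_n) _ in hB' *.
  have mD : measurable D by exact: bigcup_measurable.
  have mB' := N_measurable NB'.
  rewrite [e]splitr; apply: le_lt_trans (ltrD En hB').
  have mEn := mE n.
  have [m1 m2] := (measurableY mUF mB', measurableY mD mB').
  rewrite -lee_fin EFinD !fine_probability//.
  apply: le_trans (measureU2 _ _ _) => //.
  apply: le_measure; rewrite ?inE//; first exact: measurableU.
  move=> x; rewrite /E -/D /setY /setD /setU /=.
  have : D x -> (\bigcup_k F k) x by move=> [k _ Fkx]; exists k.
  by have := pselect (D x); tauto.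
apply: (smallest_sub _ _ mB) => [|A CA]; last first.
  split; first exact: sub_sigma_algebra.
  by move=> e e0; exists A; [exact: CN|rewrite setYK measure0].
split.
- split; first exact: measurable0.
  by move=> e e0; exists set0 => //; rewrite setYK measure0.
- move=> A; rewrite -/(approx A) => -[mA hA]; rewrite setTD; split; first exact: measurableC.
  move=> e /hA[B' NB' lt_e]; exists (~` B'); first exact: NC.
  rewrite [X in P X](_ : _ = A `+` B')//.
  by rewrite /setY !setDE !setCK setUC [~` A `&` _]setIC [~` B' `&` _]setIC.
- exact: approxU.
Qed.

End approximation.

(** * Finite boxes, shifts and independence in the product space *)

Section boxes.
Context (R : realType) (G : groupType) (d : measure_display)
  (K : measurableType d).
Local Notation Om := (prod_space G K).
Implicit Types A B : G -> set K.

Definition box A : set Om := [set w | forall c, A c (w c)].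

(** Sides are indexed by all of [G], almost all of them full, so that intersections and shifts of
    boxes need no change of index set. *)
Definition finite_box A := (forall c, measurable (A c)) /\
  exists J : seq G, forall c, c \notin J -> A c = setT.

Lemma boxI A B : box A `&` box B = box (fun c => A c `&` B c).
Proof.
by apply/seteqP; split=> w => [[hA hB] c|h]; split=> // c; have [] := h c.
Qed.

Lemma finite_boxI A B :
  finite_box A -> finite_box B -> finite_box (fun c => A c `&` B c).
Proof.
move=> [mA [J hJ]] [mB [L hL]]; split; first by move=> c; exact: measurableI.
exists (J ++ L) => c; rewrite mem_cat negb_or => /andP[cJ cL].
by rewrite hJ// hL// setTI.
Qed.

Lemma measurable_coordinate c (A : set K) :
  measurable A -> measurable ([set w | A (w c)] : set Om).
Proof. by move=> mA; apply: sub_sigma_algebra; exists c, A. Qed.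

Lemma measurable_box A : finite_box A -> measurable (box A).
Proof.
move=> [mA [J hJ]].
rewrite [X in measurable X](_ : _ =
  \bigcap_(c in [set` J]) [set w | A c (w c)]).
  apply: fin_bigcap_measurable; first exact: finite_seq.
  by move=> c _; exact: measurable_coordinate.
apply/seteqP; split=> [w h c _|w h c]; first exact: h.
by have [/h //|/hJ ->] := boolP (c \in J).
Qed.

Definition coordinate_box c (A : set K) : G -> set K :=
  fun b => if b == c then A else setT.

Lemma box_coordinate c (A : set K) : box (coordinate_box c A) = [set w | A (w c)].
Proof.
apply/seteqP; split=> w; first by move/(_ c); rewrite /coordinate_box eqxx.
by move=> Awc b; rewrite /coordinate_box; case: eqP => // ->.
Qed.

Lemma finite_coordinate_box c (A : set K) :
  measurable A -> finite_box (coordinate_box c A).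
Proof.
move=> mA; split=> [b|]; first by rewrite /coordinate_box; case: ifP.
by exists [:: c] => b; rewrite inE /coordinate_box => /negbTE ->.
Qed.

Lemma finite_boxT : finite_box (fun=> setT).
Proof. by split=> //; exists [::]. Qed.

Lemma boxT : box (fun=> setT) = setT.
Proof. by apply/seteqP; split. Qed.

Lemma sigma_boxes :
  <<s @coordinate_sets G _ K >> = <<s [set box A | A in finite_box] >>.
Proof.
apply/seteqP; split; apply: smallest_sub.
- exact: smallest_sigma_algebra.
- move=> _ [c [A mA ->]]; apply: sub_sigma_algebra.
  by exists (coordinate_box c A); [exact: finite_coordinate_box|exact: box_coordinate].
- exact: smallest_sigma_algebra.
- by move=> _ [A hA <-]; exact: measurable_box.
Qed.

Lemma box_measure_unique (m1 m2 : {measure set Om -> \bar R}) :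
  (m1 setT < +oo)%E ->
  (forall A, finite_box A -> m1 (box A) = m2 (box A)) ->
  forall E, measurable E -> m1 E = m2 E.
Proof.
move=> m1T e12.
apply: (measure_unique [set box A | A in finite_box] (fun=> setT)) => //.
- exact: sigma_boxes.
- move=> _ _ [A hA <-] [B hB <-]; rewrite boxI.
  by exists (fun c => A c `&` B c) => //; exact: finite_boxI.
- by move=> _; exists (fun=> setT); [exact: finite_boxT|exact: boxT].
- by apply/seteqP; split=> // x _; exists 0%N.
- by move=> _ [A hA <-]; exact: e12.
Qed.

(* Finite linear combinations of box indicators are stable under products, so
   these sets form an algebra of sets, to which estimates on boxes extend by
   linearity. *)
Definition box_combination (E : set Om) := measurable E /\
  exists (I : finType) (a : I -> R) (A : I -> G -> set K),
    (forall i, finite_box (A i)) /\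
    (forall w, \1_E w = \sum_i a i * \1_(box (A i)) w).

Lemma box_combination_box A : finite_box A -> box_combination (box A).
Proof.
move=> hA; split; first exact: measurable_box.
exists 'I_1, (fun=> 1), (fun=> A); split=> // w.
by rewrite big_ord1 mul1r.
Qed.

Lemma box_combinationI E F :
  box_combination E -> box_combination F -> box_combination (E `&` F).
Proof.
move=> [mE [I [a [A [hA eA]]]]] [mF [J [b [B [hB eB]]]]].
split; first exact: measurableI.
exists (I * J)%type, (fun p => a p.1 * b p.2), (fun p c => A p.1 c `&` B p.2 c).
split=> [p|w]; first exact: finite_boxI.
rewrite indicI /= eA eB big_distrlr pair_big; apply: eq_bigr => p _ /=.
by rewrite -boxI indicI /= mulrACA.
Qed.

Lemma box_combinationC E : box_combination E -> box_combination (~` E).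
Proof.
move=> [mE [I [a [A [hA eA]]]]]; split; first exact: measurableC.
(* The indicator of the complement is 1 minus that of [E]; the added index carries the full box with
   coefficient 1. *)
exists ('I_1 + I)%type, (fun s => if s is inr i then - a i else 1),
  (fun s => if s is inr i then A i else fun=> setT).
split=> [[_|i]//|w]; first exact: finite_boxT.
rewrite big_sumType big_ord1 /= boxT indicT mulr1.
under eq_bigr do rewrite mulNr.
rewrite sumrN -eA !indicE in_setC.
by case: (w \in E); rewrite /= ?subrr ?subr0.
Qed.

Lemma box_combinationU E F :
  box_combination E -> box_combination F -> box_combination (E `|` F).
Proof.
move=> hE hF; rewrite -[_ `|` _]setCK setCU.
by apply/box_combinationC/box_combinationI; exact: box_combinationC.
Qed.

Lemma box_combination_approximation (P : probability Om R) (B : set Om) e :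
  measurable B -> 0 < e ->
  exists2 B', box_combination B' & fine (P (B `+` B')) < e.
Proof.
move=> mB; move: e; apply: algebra_approximation => //.
- by move=> A [].
- move=> _ [c [A mA ->]]; rewrite -box_coordinate; apply: box_combination_box.
  exact: finite_coordinate_box.
- rewrite -setCT -boxT; apply: box_combinationC; apply: box_combination_box.
  exact: finite_boxT.
- exact: box_combinationC.
- exact: box_combinationU.
Qed.

Lemma shiftK c :
  cancel (@bernoulli_shift G K c) (bernoulli_shift c^-1%g).
Proof. by move=> w; apply/funext => b; rewrite /bernoulli_shift mulgVK. Qed.

Lemma shift_preimage_box c A :
  bernoulli_shift c @^-1` box A = box (fun b => A (b * c^-1)%g).
Proof.
apply/seteqP; split=> w h b /=.
  by have := h (b * c^-1)%g; rewrite /bernoulli_shift mulgVK.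
by have := h (b * c)%g; rewrite mulgK.
Qed.

Lemma finite_box_shift c A :
  finite_box A -> finite_box (fun b => A (b * c^-1)%g).
Proof.
move=> [mA [J hJ]]; split=> //; exists [seq (b * c)%g | b <- J] => b bJ.
apply: hJ; apply: contra bJ => bJ; apply/mapP.
by exists (b * c^-1)%g => //; rewrite mulgVK.
Qed.

Lemma measurable_shift c :
  measurable_fun setT (bernoulli_shift c : Om -> Om).
Proof.
apply: (measurability [set box A | A in finite_box]).
  exact: sigma_boxes.
move=> _ [_ [A hA <-] <-]; rewrite setTI shift_preimage_box.
by apply: measurable_box; exact: finite_box_shift.
Qed.

Lemma measurable_shift_preimage c (E : set Om) :
  measurable E -> measurable (bernoulli_shift c @^-1` E : set Om).
Proof. by move=> mE; have := measurable_shift c measurableT mE; rewrite setTI. Qed.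

Lemma shift_image c (E : set (G -> K)) :
  bernoulli_shift c @` E = bernoulli_shift c^-1%g @^-1` E.
Proof.
apply/seteqP; split=> [_ [w Ew <-]|w Ew]; first by rewrite /= shiftK.
by exists (bernoulli_shift c^-1%g w) => //; rewrite -{1}(invgK c) shiftK.
Qed.

Lemma box_combination_shift c E :
  box_combination E -> box_combination (bernoulli_shift c @^-1` E).
Proof.
move=> [mE [I [a [A [hA eA]]]]]; split; first exact: measurable_shift_preimage.
exists I, a, (fun i b => A i (b * c^-1)%g); split=> [i|w].
  exact: finite_box_shift.
have pre_indic (D : set Om) w' : \1_(bernoulli_shift c @^-1` D) w' =
  \1_D (bernoulli_shift c w') :> R by [].
by rewrite pre_indic eA; apply: eq_bigr => i _; rewrite -shift_preimage_box.
Qed.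

Variables (kappa : probability K R) (P : probability Om R).
Hypothesis PK : product_measure kappa P.

(** The coordinates read by a coding are names of cells, so independence is needed along an
    arbitrary injection [s] into [G]. The sides are moved along [s] and set to [setT] off its
    range. *)
Lemma product_measure_injective (I : finType) (s : I -> G) (A : I -> set K) :
  injective s -> (forall i, measurable (A i)) ->
  P [set w | forall i, A i (w (s i))] = (\prod_i kappa (A i))%E.
Proof.
move=> inj_s mA.
pose B c := if [pick i | s i == c] is Some i then A i else setT.
have Bs i : B (s i) = A i.
  rewrite /B; case: pickP => [j /eqP/inj_s -> //|/(_ i)]; by rewrite eqxx.
have mB c : measurable (B c) by rewrite /B; case: pickP.
have Ju : uniq [seq s i | i <- enum I] by rewrite map_inj_uniq ?enum_uniq.
have := PK Ju mB; rewrite big_map big_enum.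
under eq_bigr do rewrite Bs.
move=> <-; congr (P _); apply/seteqP; split=> w h.
  by move=> _ /mapP[i _ ->]; rewrite Bs.
by move=> i; rewrite -[A i]Bs; apply/h/map_f; rewrite mem_enum.
Qed.

Lemma box_index A : finite_box A -> exists (I : finType) (s : I -> G),
  injective s /\ box A = [set w | forall i, A (s i) (w (s i))].
Proof.
move=> [mA [J hJ]]; exists (seq_sub J), val; split; first exact: val_inj.
apply/seteqP; split=> w h => [i|c]; first exact: h.
by have [cJ|/hJ ->//] := boolP (c \in J); exact: (h (SeqSub cJ)).
Qed.

(** [P] and its image under the shift agree on boxes, because right multiplication by [c] keeps
    distinct coordinates distinct. *)
Lemma product_measure_shift c (E : set Om) :
  measurable E -> P (bernoulli_shift c @^-1` E) = P E.
Proof.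
move=> mE; symmetry.
rewrite -[RHS]/(pushforward P (bernoulli_shift c : Om -> Om) E).
move: E mE; apply: box_measure_unique; first exact: measurable_shift.
  by apply: (le_lt_trans (probability_le1 P _)); rewrite ?ltry.
move=> mshift A hA; rewrite /= /pushforward.
have [I [s [inj_s eA]]] := box_index hA.
have mA i : measurable (A (s i)) by exact: hA.1.
have inj_sc : injective (fun i => s i * c)%g by move=> i j /mulIg/inj_s.
rewrite eA; exact: etrans (product_measure_injective inj_s mA)
  (esym (product_measure_injective inj_sc mA)).
Qed.

End boxes.

(** * Concentration of random codings *)

Lemma eventually_forall (I : finType) (Q : I -> nat -> Prop) :
  (forall i, exists M, forall m, (M <= m)%N -> Q i m) ->
  exists M, forall m, (M <= m)%N -> forall i, Q i m.
Proof.
move=> /choice[M hM]; exists (\max_i M i)%N => m Mm i; apply: hM.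
exact: leq_trans (leq_bigmax i) Mm.
Qed.

Section second_moment.
Context (R : realType) (d : measure_display) (T : measurableType d).
Variable P : probability T R.

Lemma finite_code_measure (I : finType) (c : T -> I) (Q : set I) :
  (forall i, measurable [set x | c x = i]) ->
  fine (P [set x | Q (c x)]) = \sum_i fine (P [set x | c x = i]) * \1_Q i.
Proof.
move=> mc.
apply: (has_mean_unique (has_mean_indic P (measurable_finite_preimage Q mc))).
under eq_bigr do rewrite mulrC.
have -> : \1_[set x | Q (c x)] =
    (fun x => \sum_i \1_Q i * \1_[set x | c x = i] x) :> (T -> R).
  apply/funext => x; rewrite (bigD1 (c x))//= big1 ?addr0.
    by rewrite (@indicE _ _ [set y | c y = c x]) mem_set// mulr1.
  move=> i /eqP ic; rewrite (@indicE _ _ [set y | c y = i]) memNset ?mulr0//.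
  by move=> /esym.
by apply: has_mean_sum => i; apply: has_meanZ; exact: has_mean_indic.
Qed.

(** In the expanded square the pair [i], [j] contributes [m i * m j * cov i j]. Independence makes
    this vanish for a good pair, and [cov] is at most 1 for a bad one. *)
Lemma second_moment_le (I : finType) (m : I -> R) (F : I -> set T) (p : R)
    (bad : rel I) :
  (forall i, 0 <= m i) -> \sum_i m i = 1 -> (forall i, measurable (F i)) ->
  0 <= p <= 1 ->
  (forall i j, ~~ bad i j -> [/\ fine (P (F i)) = p, fine (P (F j)) = p &
     fine (P (F i `&` F j)) = p * p]) ->
  exists2 v, has_mean P (fun w => (\sum_i m i * \1_(F i) w - p) ^+ 2) v &
    v <= \sum_i m i * \sum_j m j * (bad i j)%:R.
Proof.
move=> m0 m1 mF /andP[p0 p1] good.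
(* Centred at [p], not at the actual probabilities, which may differ from [p] on bad pairs. *)
pose cov i j := fine (P (F i `&` F j)) - p * fine (P (F i))
  - p * fine (P (F j)) + p * p.
have mean_cov i j : has_mean P
    (fun w => (\1_(F i) w - p) * (\1_(F j) w - p)) (cov i j).
  have := has_meanD (has_meanD (has_meanD
    (has_mean_indic P (measurableI _ _ (mF i) (mF j)))
    (has_meanZ (- p) (has_mean_indic P (mF i))))
    (has_meanZ (- p) (has_mean_indic P (mF j)))) (has_mean_cst P (p * p)).
  rewrite /cov; congr (has_mean _ _ _); last by rewrite !mulNr.
  apply/funext => w; rewrite indicI /=.
  ring.
have cov_le i j : cov i j <= (bad i j)%:R.
  case: (boolP (bad i j)) => [_|/good[e1 e2 e3]]; last first.
    by rewrite /cov e1 e2 e3 subrr sub0r addNr.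
  apply: has_mean_le (mean_cov i j) (has_mean_cst P 1) _ => w.
  have ind (D : set T) : `|\1_D w - p| <= 1.
    rewrite indicE ler_norml; case: (w \in D) => /=; lra.
  by apply: le_trans (ler_norm _) _; rewrite normrM mulr_ile1.
exists (\sum_i \sum_j m i * m j * cov i j).
  rewrite (_ : (fun w => _) = (fun w => \sum_i \sum_j
    m i * m j * ((\1_(F i) w - p) * (\1_(F j) w - p)))).
    by do 2!apply: has_mean_sum => ?; exact: has_meanZ.
  apply/funext => w.
  have -> : \sum_i m i * \1_(F i) w - p = \sum_i m i * (\1_(F i) w - p).
    under [RHS]eq_bigr do rewrite mulrBr.
    by rewrite sumrB -mulr_suml m1 mul1r.
  rewrite expr2 big_distrlr; apply: eq_bigr => i _; apply: eq_bigr => j _.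
  by rewrite mulrACA.
apply: ler_sum => i _; rewrite big_distrr; apply: ler_sum => j _ /=.
by rewrite -mulrA; do 2!apply: ler_wpM2l => //.
Qed.

End second_moment.

Section coding.
Context (R : realType) (G : groupType) (d : measure_display)
  (X : measurableType d) (mu : probability X R) (f : G -> X -> X).
Hypotheses (fP : pmp_action mu f) (ffree : free_action mu f)
  (Ginf : infinite_set [set: G]).
Context (dK : measure_display) (K : measurableType dK)
  (kappa : probability K R) (P : probability (prod_space G K) R).
Hypothesis PK : product_measure kappa P.
Variables (U : nat -> set X) (e : nat -> G).
Hypotheses (mU : forall k, measurable (U k))
  (sepU : forall x y, x <> y -> exists k, U k x /\ ~ U k y)
  (inj_e : injective e).
Local Notation Om := (prod_space G K).

(** Here the elements of [G] serve as names of cells: distinct cells read distinct coordinates of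
    [w]. *)
Definition label m (t : {ffun 'I_m -> bool}) : G := e (enum_rank t).

Lemma label_inj m : injective (@label m).
Proof. by move=> s t /inj_e/val_inj/enum_rank_inj. Qed.

(* For [w] drawn from [P] the cells of [bits m] receive independent labels, so
   [coding w m x] is the process of labels seen along the orbit of [x]. *)
Definition coding (w : Om) m (x : X) : Om :=
  fun c => w (label (bits U m (f c x))).

Lemma coding_equivariant w m c x :
  coding w m (f c x) = bernoulli_shift c (coding w m x).
Proof.
by apply/funext => b; rewrite /coding /bernoulli_shift (pmp_actM fP).
Qed.

Lemma measurable_bits_act m c t : measurable [set x | bits U m (f c x) = t].
Proof. by apply: measurable_bits_comp => //; exact: (pmp_measurable fP). Qed.

Lemma measurable_coding_preimage w m (E : set Om) :
  measurable E -> measurable (coding w m @^-1` E).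
Proof.
move=> mE; have mc : measurable_fun setT (coding w m : X -> Om).
  apply: (measurability (@coordinate_sets G _ K : set (set Om))) => // _ [_ [c [A mA ->]] <-].
  rewrite setTI; apply: (@measurable_finite_preimage _ _ _
    (fun x => bits U m (f c x)) [set t | A (w (label t))]).
  exact: measurable_bits_act.
by have := mc measurableT _ mE; rewrite setTI.
Qed.

(** The discrepancy is dominated by a function of small mean: its own measurability in [w] then
    never has to be settled, and such bounds add up in linear combinations. *)
Definition concentrates (E : set Om) := forall eta : R, 0 < eta ->
  exists M, forall m, (M <= m)%N -> exists g v, [/\ has_mean P g v, v < eta &
    forall w, `|fine (mu (coding w m @^-1` E)) - fine (P E)| <= g w].

Lemma fine_product_measure (I : finType) (s : I -> G) (A : I -> set K) :
  injective s -> (forall i, measurable (A i)) ->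
  fine (P [set w | forall i, A i (w (s i))]) = \prod_i fine (kappa (A i)).
Proof.
move=> inj_s mA; rewrite (product_measure_injective PK)//.
rewrite (eq_bigr (fun i => (fine (kappa (A i)))%:E)) => [|i _].
  by rewrite prodEFin.
by rewrite fine_probability.
Qed.

(** Whether the coding of [x] lies in [E] depends only on the pattern [code x] of cells met by the
    orbit piece, so the measure of the preimage is the average of the indicators of [F i] with
    weights [wt i]. A pair of patterns is bad if one repeats a cell or both share one; for each [k],
    [l] these three events have weight at most [delta] each. *)
Lemma box_second_moment (J : finType) (s : J -> G) (A : J -> set K) m delta :
  injective s -> (forall j, measurable (A j)) -> 0 <= delta ->
  (forall t, fine (mu [set x | bits U m x = t]) <= delta) ->
  (forall k l, k != l -> fine (mu [set x |
    bits U m (f (s k) x) = bits U m (f (s l) x)]) <= delta) ->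
  let E := [set w : Om | forall j, A j (w (s j))] in
  exists2 v, has_mean P
    (fun w => (fine (mu (coding w m @^-1` E)) - fine (P E)) ^+ 2) v &
    v <= 3 * #|J|%:R ^+ 2 * delta.
Proof.
move=> inj_s mA delta0 cells collisions E.
pose I : finType := {ffun J -> {ffun 'I_m -> bool}}.
pose code x : I := [ffun j => bits U m (f (s j) x)].
pose F (i : I) : set Om := [set w | forall j, A j (w (label (i j)))].
pose wt i := fine (mu [set x | code x = i]).
pose p := fine (P E).
have mcode i : measurable [set x | code x = i].
  apply: (@measurable_ffun_code _ _ _ _ (fun j x => bits U m (f (s j) x))) => j t.
  exact: measurable_bits_act.
have wt_sum (Q : pred I) :
    \sum_i wt i * (Q i)%:R = fine (mu [set x | Q (code x)]).
  rewrite (finite_code_measure mu [set i | Q i])//; apply: eq_bigr => i _.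
  by rewrite indicE; congr (_ * (nat_of_bool _)%:R); apply/idP/idP; rewrite inE.
have wt0 i : 0 <= wt i by exact: fine_probability_ge0.
have wt1 : \sum_i wt i = 1.
  under eq_bigr do rewrite -[wt _]mulr1.
  rewrite (wt_sum xpredT) [X in mu X](_ : _ = setT) ?probability_setT//.
  by apply/seteqP; split.
have pE : p = \prod_j fine (kappa (A j)) by exact: fine_product_measure.
have mE : measurable E.
  rewrite [X in measurable X](_ : _ = \bigcap_(j in setT) [set w | A j (w (s j))]).
    apply: fin_bigcap_measurable => [|j _]; first exact: finite_finset.
    exact: measurable_coordinate.
  by apply/seteqP; split=> w h j; move: (h j) => //; exact.
have mF i : measurable (F i).
  rewrite [X in measurable X](_ : _ =
      \bigcap_(j in setT) [set w | A j (w (label (i j)))]).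
    apply: fin_bigcap_measurable => [|j _]; first exact: finite_finset.
    exact: measurable_coordinate.
  by apply/seteqP; split=> w h j; move: (h j) => //; exact.
have PF (i : I) : injective i -> fine (P (F i)) = p.
  move=> inj_i; rewrite pE (@fine_product_measure _ (fun j => label (i j)) A)//.
  by move=> k l /label_inj/inj_i.
have PFF (i j : I) : injective i -> injective j -> (forall k l, i k != j l) ->
    fine (P (F i `&` F j)) = p * p.
  move=> inj_i inj_j ij.
  (* Two injective patterns without common cells combine into one injective family over [J + J]. *)
  pose r (u : J + J) := match u with inl k => label (i k) | inr k => label (j k) end.
  pose B (u : J + J) := match u with inl k => A k | inr k => A k end.
  have -> : F i `&` F j = [set w | forall u, B u (w (r u))].
    apply/seteqP; split=> [w [h1 h2] [k|k]|w h]; [exact: h1|exact: h2|].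
    by split=> k; [exact: (h (inl k))|exact: (h (inr k))].
  rewrite fine_product_measure; first by rewrite big_sumType /= -pE.
    move=> [k|k] [l|l] /= /label_inj.
    - by move/inj_i => ->.
    - by move=> kl; have := ij k l; rewrite kl eqxx.
    - by move=> kl; have := ij l k; rewrite kl eqxx.
    - by move/inj_j => ->.
  by case.
pose col (i : I) k l := (k != l) && (i k == i l).
pose bad (i j : I) := [exists k, exists l, [|| col i k l, col j k l | i k == j l]].
have good i j : ~~ bad i j -> [/\ fine (P (F i)) = p, fine (P (F j)) = p &
    fine (P (F i `&` F j)) = p * p].
  move=> nbad; have h k l : [/\ ~~ col i k l, ~~ col j k l & i k != j l].
    by move: nbad => /existsPn/(_ k)/existsPn/(_ l); rewrite !negb_or => /and3P.
  have inj_i : injective i.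
    move=> k l kl; have [+ _ _] := h k l.
    by rewrite /col kl eqxx andbT negbK => /eqP.
  have inj_j : injective j.
    move=> k l kl; have [_ + _] := h k l.
    by rewrite /col kl eqxx andbT negbK => /eqP.
  by split; [exact: PF|exact: PF|apply: PFF => // k l; have [] := h k l].
have p01 : 0 <= p <= 1 by rewrite fine_probability_ge0 fine_probability_le1.
have [v hv v_le] := second_moment_le wt0 wt1 mF p01 good.
exists v.
  move: hv; congr (has_mean _ _ _); apply/funext => w; congr ((_ - _) ^+ 2).
  have -> : coding w m @^-1` E = [set x | [set i | F i w] (code x)].
    apply/seteqP; split=> x h j; have := h j; by rewrite /coding /= ffunE.
  by rewrite finite_code_measure//; apply: eq_bigr.
apply: (le_trans v_le).
have col_le k l : \sum_i wt i * (col i k l)%:R <= delta.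
  rewrite (wt_sum (fun i => col i k l)); case: (eqVneq k l) => [->|kl].
    rewrite [X in mu X](_ : _ = set0) ?measure0//.
    by apply/seteqP; split=> // x; rewrite /= /col eqxx.
  rewrite [X in mu X](_ : _ = [set x | bits U m (f (s k) x) = bits U m (f (s l) x)]).
    exact: collisions.
  apply/seteqP; split=> x; rewrite /= /col !ffunE kl /=; first by move/eqP.
  by move=> ->.
(* By invariance of [mu], the cell of [f (s l) x] is distributed like that of [x], and each fixed
   cell has measure at most [delta]. *)
have cross_le (i : I) k l : \sum_j wt j * (i k == j l)%:R <= delta.
  rewrite (wt_sum (fun j => i k == j l)).
  rewrite [X in mu X](_ : _ = f (s l) @^-1` [set x | bits U m x = i k]).
    by rewrite (pmp_preserving fP)//; exact: measurable_bits.
  apply/seteqP; split=> x; rewrite /= ffunE; first by move/eqP.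
  by move=> ->.
have bad_le i j : (bad i j)%:R <= \sum_k \sum_l
    ((col i k l)%:R + (col j k l)%:R + (i k == j l)%:R) :> R.
  case: (boolP (bad i j)) => [/existsP[k /existsP[l h]]|_]; last first.
    by rewrite sumr_ge0// => k _; rewrite sumr_ge0// => l _; rewrite !addr_ge0.
  have term_ge0 a b : 0 <= (col i a b)%:R + (col j a b)%:R + (i a == j b)%:R :> R.
    by rewrite !addr_ge0.
  rewrite (bigD1 k)//= (bigD1 l)//= -!addrA (le_trans (y := (col i k l)%:R +
    ((col j k l)%:R + (i k == j l)%:R)))//.
    by case: (col i k l) (col j k l) (i k == j l) h => [] [] [] //= _; lra.
  by rewrite !addrA -[leRHS]addrA lerDl addr_ge0 ?sumr_ge0// => a _; rewrite sumr_ge0.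
have sum_delta c : \sum_(k : J) \sum_(l : J) c = #|J|%:R ^+ 2 * c.
  by rewrite !sumr_const expr2 -mulrA !mulr_natl.
(* Averaging over [j] alone bounds the repeats in [j] and the shared cells; the repeats in [i] wait
   for the average over [i]. *)
have inner i : \sum_j wt j * (bad i j)%:R <=
    (\sum_k \sum_l (col i k l)%:R) + 2 * #|J|%:R ^+ 2 * delta.
  have -> : 2 * #|J|%:R ^+ 2 * delta = \sum_(k : J) \sum_(l : J) (delta + delta).
    by rewrite sum_delta; ring.
  apply: (le_trans (y := \sum_j wt j * \sum_k \sum_l
      ((col i k l)%:R + (col j k l)%:R + (i k == j l)%:R))).
    by apply: ler_sum => j _; apply: ler_wpM2l.
  under eq_bigr do rewrite big_distrr/=.
  rewrite exchange_big -big_split/=; apply: ler_sum => k _.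
  under eq_bigr do rewrite big_distrr/=.
  rewrite exchange_big -big_split/=; apply: ler_sum => l _.
  under eq_bigr do rewrite !mulrDr.
  rewrite !big_split/= -mulr_suml wt1 mul1r -addrA lerD2l.
  exact: lerD (col_le k l) (cross_le i k l).
apply: (le_trans (y := \sum_i wt i * ((\sum_k \sum_l (col i k l)%:R) +
    2 * #|J|%:R ^+ 2 * delta))).
  by apply: ler_sum => i _; apply: ler_wpM2l.
under eq_bigr do rewrite mulrDr.
rewrite big_split/= -mulr_suml wt1 mul1r.
have -> : 3 * #|J|%:R ^+ 2 * delta = \sum_(k : J) \sum_(l : J) delta +
    2 * #|J|%:R ^+ 2 * delta by rewrite sum_delta; ring.
rewrite lerD2r.
under eq_bigr do rewrite big_distrr/=.
rewrite exchange_big; apply: ler_sum => k _.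
under eq_bigr do rewrite big_distrr/=.
by rewrite exchange_big; apply: ler_sum => l _; exact: col_le.
Qed.

Lemma concentrates_box A : finite_box A -> concentrates (box A).
Proof.
move=> hA eta eta0; have [J [s [inj_s ->]]] := box_index hA.
have mA j : measurable (A (s j)) by exact: hA.1.
(* Makes [3 * #|J|^2 * delta] at most [eta^2 / 2]; the successor avoids division by zero for empty
   [J]. *)
pose delta := eta ^+ 2 / (6 * #|J|.+1%:R ^+ 2).
have delta0 : 0 < delta by rewrite divr_gt0 ?exprn_gt0// mulr_gt0// exprn_gt0.
have [M1 hM1] := bits_cells_lt mU sepU
  (free_action_atomless fP ffree Ginf) delta0.
have ev_collision (u : J * J) : exists M, forall m, (M <= m)%N ->
    u.1 != u.2 -> fine (mu [set x |
    bits U m (f (s u.1) x) = bits U m (f (s u.2) x)]) < delta.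
  case: (eqVneq u.1 u.2) => [_|kl]; first by exists 0%N.
  have skl : s u.1 <> s u.2 by move=> /inj_s kl'; rewrite kl' eqxx in kl.
  have [M hM] := bits_collision_lt mU sepU (pmp_measurable fP (s u.1))
    (pmp_measurable fP (s u.2)) (free_action_collision ffree skl) delta0.
  by exists M => m /hM.
have [M2 hM2] := eventually_forall ev_collision.
exists (maxn M1 M2) => m; rewrite geq_max => /andP[/hM1 cells /hM2 collisions].
have [||v hv v_le] := box_second_moment inj_s mA (ltW delta0) (m := m).
- by move=> t; apply/ltW.
- by move=> k l kl; apply/ltW/(collisions (k, l)).
(* The dominating function is [a^2 / eta + eta / 4] with [a] the discrepancy; its mean is at most
   [eta / 2 + eta / 4]. *)
have mean_g := has_meanD (has_meanZ eta^-1 hv) (has_mean_cst P (eta / 4)).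
eexists; exists (eta^-1 * v + eta / 4); split; first exact: mean_g.
  have v_half : v <= eta ^+ 2 / 2.
    apply: (le_trans v_le); rewrite /delta mulrA ler_pdivrMr; last first.
      by rewrite mulr_gt0// exprn_gt0.
    have nS : #|J|%:R ^+ 2 <= #|J|.+1%:R ^+ 2 :> R.
      by rewrite ler_sqr ?nnegrE// ler_nat.
    have : #|J|%:R ^+ 2 * eta ^+ 2 <= #|J|.+1%:R ^+ 2 * eta ^+ 2.
      by apply: ler_wpM2r => //; exact: exprn_ge0 (ltW eta0).
    lra.
  have : eta^-1 * v <= eta / 2 by rewrite ler_pdivrMl// mulrA -expr2.
  lra.
move=> w; set a := fine _ - _.
(* AM-GM: [eta |a| <= a^2 + eta^2 / 4] *)
have amgm : `|a| * eta <= a ^+ 2 + eta ^+ 2 / 4.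
  have := sqr_ge0 (`|a| - eta / 2); rewrite -(real_normK (num_real a)); lra.
rewrite -(ler_pM2r eta0); apply: (le_trans amgm).
by rewrite mulrDl [eta^-1 * _]mulrC mulfVK ?gt_eqF// [eta / 4 * _]mulrAC -expr2.
Qed.

Lemma concentrates_box_combination E :
  box_combination R E -> concentrates E.
Proof.
move=> [mE [I [a [A [hA eA]]]]] eta eta0.
(* The added 1 keeps [c] positive and makes the final bound strict. *)
pose c := 1 + \sum_i `|a i|.
have c0 : 0 < c by rewrite ltr_pwDl// sumr_ge0.
have [M hM] := eventually_forall (fun i =>
  concentrates_box (hA i) (divr_gt0 eta0 c0)).
exists M => m /hM/choice[g /choice[v gv]].
exists (fun w => \sum_i `|a i| * g i w), (\sum_i `|a i| * v i); split.
- by apply: has_mean_sum => i; apply: has_meanZ; have [] := gv i.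
- apply: (@le_lt_trans _ _ (\sum_i `|a i| * (eta / c))).
    by apply: ler_sum => i _; apply: ler_wpM2l => //; have [_ /ltW] := gv i.
  rewrite -mulr_suml mulrA ltr_pdivrMr// mulrC ltr_pM2l// /c.
  by rewrite ltrDr.
move=> w.
have -> : fine (P E) = \sum_i a i * fine (P (box (A i))).
  apply: (has_mean_unique (has_mean_indic P mE)).
  rewrite (_ : \1_E = fun w => \sum_i a i * \1_(box (A i)) w); last exact/funext.
  apply: has_mean_sum => i; apply: has_meanZ; apply: has_mean_indic.
  exact: measurable_box.
have -> : fine (mu (coding w m @^-1` E)) =
    \sum_i a i * fine (mu (coding w m @^-1` box (A i))).
  apply: (has_mean_unique (has_mean_indic mu (measurable_coding_preimage w m mE))).
  rewrite (_ : \1_(coding w m @^-1` E) =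
      fun x => \sum_i a i * \1_(coding w m @^-1` box (A i)) x).
    apply: has_mean_sum => i; apply: has_meanZ; apply: has_mean_indic.
    by apply: measurable_coding_preimage; exact: measurable_box.
  by apply/funext => x; exact: (eA (coding w m x)).
rewrite -sumrB; apply: (le_trans (ler_norm_sum _ _ _)); apply: ler_sum => i _.
rewrite -mulrBr normrM; apply: ler_wpM2l => //.
by have [_ _] := gv i; exact.
Qed.

(** The dominating functions of the finitely many events are summed, and a [w] is chosen where the
    sum is below [eta]. Each function is nonnegative, as it bounds an absolute value, so each is
    itself below [eta] at this [w]. *)
Lemma coding_approximation (L : finType) (E : L -> set Om) eta :
  (forall l, box_combination R (E l)) -> 0 < eta ->
  exists w m, forall l,
    `|fine (mu (coding w m @^-1` E l)) - fine (P (E l))| < eta.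
Proof.
move=> hE eta0.
have n0 : 0 < #|L|.+1%:R :> R by [].
have [M hM] := eventually_forall (fun l =>
  concentrates_box_combination (hE l) (divr_gt0 eta0 n0)).
have /choice[g /choice[v gv]] := hM M (leqnn M).
have hmean : has_mean P (fun w => \sum_l g l w) (\sum_l v l).
  by apply: has_mean_sum => l; have [] := gv l.
have [|w hw] := has_mean_exists_lt hmean (a := eta).
  apply: (@le_lt_trans _ _ (\sum_(l : L) (eta / #|L|.+1%:R))).
    by apply: ler_sum => l _; have [_ /ltW] := gv l.
  rewrite sumr_const -[ltLHS]mulr_natr mulrAC ltr_pdivrMr// ltr_pM2l//.
  by rewrite ltr_nat.
exists w, M => l; apply: le_lt_trans hw.
have gw k : `|fine (mu (coding w M @^-1` E k)) - fine (P (E k))| <= g k w.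
  by have [_ _] := gv k; exact.
rewrite (bigD1 l)//=; apply: (le_trans (gw l)); rewrite lerDl sumr_ge0// => k _.
exact: le_trans (gw k).
Qed.

End coding.

(** * Weak containment *)

Section measure_distance.
Context (R : realType) (d : measure_display) (T : measurableType d).
Variable P : probability T R.

Lemma fine_probabilityU_le (A B : set T) : measurable A -> measurable B ->
  fine (P (A `|` B)) <= fine (P A) + fine (P B).
Proof.
move=> mA mB; rewrite -lee_fin EFinD !fine_probability//; last exact: measurableU.
exact: measureU2.
Qed.

Lemma fine_probability_dist (A B : set T) : measurable A -> measurable B ->
  `|fine (P A) - fine (P B)| <= fine (P (A `+` B)).
Proof.
have dist (C D : set T) : measurable C -> measurable D ->
    fine (P C) <= fine (P D) + fine (P (C `+` D)).
  move=> mC mD; have mY := measurableY mC mD.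
  apply: le_trans (fine_probabilityU_le mD mY).
  apply: le_fine_probability => //; first exact: measurableU.
  by move=> x; rewrite /setY /setD /setU /=; have := pselect (D x); tauto.
move=> mA mB; rewrite ler_norml.
have := dist _ _ mA mB; have := dist _ _ mB mA; rewrite [B `+` A]setYC.
by move=> h1 h2; apply/andP; split; lra.
Qed.

Lemma probability_ae_eq (A B : set T) : measurable A -> measurable B ->
  P.-negligible (A `+` B) -> P A = P B.
Proof.
move=> mA mB /(measure_negligible (measurableY mA mB)) Y0.
have := fine_probability_dist mA mB; rewrite Y0 normr_le0 subr_eq0 => /eqP e.
by rewrite -(fine_probability P mA) e fine_probability.
Qed.

End measure_distance.

Section weak_containment.
Context (R : realType) (G : groupType) (d : measure_display)
  (X : measurableType d) (mu : probability X R) (f : G -> X -> X)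
  (dK : measure_display) (K : measurableType dK)
  (P : probability (prod_space G K) R).
Local Notation Om := (prod_space G K).

Lemma weakly_contains_bernoulli (kappa : probability K R) :
  infinite_set [set: G] -> pmp_action mu f -> free_action mu f ->
  product_measure kappa P -> weakly_contains mu f P (@bernoulli_shift G K).
Proof.
move=> Ginf fP ffree PK n B mB S /finite_seqP[s ->] e e0.
have e4 : 0 < e / 4 by rewrite divr_gt0.
have /choice[B' hB'] i : exists B' : set Om,
    box_combination R B' /\ fine (P (B i `+` B')) < e / 4.
  by have [B' ? ?] := box_combination_approximation P (mB i) e4; exists B'.
have mB' i : measurable (B' i) by have [[]] := hB' i.
have [U [mU sepU]] := standard_borel_separating (pmp_standard fP).
have [name inj_name] := infinite_set_injection Ginf.
(* One event for each triple of [i], [j] and [c] in the finite set, so that a single coding serves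
   all the inequalities. *)
pose E (l : 'I_n * 'I_n * seq_sub s) : set Om :=
  bernoulli_shift (val l.2)^-1%g @^-1` B' l.1.1 `&` B' l.1.2.
have [l|w [m hw]] := coding_approximation fP ffree Ginf PK mU sepU inj_name (E := E)
    _ (divr_gt0 e0 (ltr0n R 2)).
  apply: box_combinationI; last exact: (hB' _).1.
  by apply: box_combination_shift; have [] := hB' l.1.1.
pose code := coding f U name w m.
exists (fun i => code @^-1` B' i) => [i|i j c cs].
  exact: (measurable_coding_preimage fP _ mU _ _ (mB' i)).
have := hw (i, j, SeqSub cs); set E' := E _.
have -> : code @^-1` E' = f c @` (code @^-1` B' i) `&` code @^-1` B' j.
  rewrite (act_image fP); congr (_ `&` _).
  by apply/seteqP; split=> x /=; rewrite /code (coding_equivariant fP).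
rewrite shift_image; set D := _ `&` B j.
have mpre := @measurable_shift_preimage G _ K c^-1%g.
have mY k : measurable (B k `+` B' k) by exact: measurableY.
have mE' : measurable E' by apply: measurableI => //; exact: mpre.
have mD : measurable D by apply: measurableI => //; exact: mpre.
(* Replacing [B i] and [B j] by their approximations costs [e / 4] each, the first by shift
   invariance of [P]. *)
have E'D : `|fine (P E') - fine (P D)| < e / 2.
  apply: le_lt_trans (fine_probability_dist P mE' mD) _.
  apply: (@le_lt_trans _ _ (fine (P
    (bernoulli_shift c^-1%g @^-1` (B i `+` B' i) `|` (B j `+` B' j))))).
    apply: le_fine_probability; [exact: measurableY| |].
      by apply: measurableU => //; exact: mpre.
    move=> w'; rewrite /E' /E /D /setY /setD /setU /setI /preimage /=.
    have := (pselect (B i (bernoulli_shift c^-1%g w')), pselect (B j w')).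
    have := (pselect (B' i (bernoulli_shift c^-1%g w')), pselect (B' j w')).
    tauto.
  apply: le_lt_trans (fine_probabilityU_le P (mpre _ (mY i)) (mY j)) _.
  rewrite (product_measure_shift PK)//.
  have [[_ hi] [_ hj]] := (hB' i, hB' j).
  by move: hi hj; lra.
move=> hmu; rewrite [e]splitr.
apply: le_lt_trans (ltrD hmu E'D).
by apply: le_trans (ler_normD _ _); rewrite addrA subrK.
Qed.

(** Sets pulled back along [phi] have the same correlations as the originals, because equivariance
    fails only on a null set. *)
Lemma weakly_contains_factor (dY : measure_display) (Y : measurableType dY)
    (nu : probability Y R) (g : G -> Y -> Y) :
  pmp_action nu g -> factor_of nu g P (@bernoulli_shift G K) ->
  weakly_contains mu f P (@bernoulli_shift G K) -> weakly_contains mu f nu g.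
Proof.
move=> gP [phi [mphi phi_nu phi_eq _]] h n B mB S Sfin e e0.
have mpre (D : set Y) : measurable D -> measurable (phi @^-1` D).
  by move=> mD; have := mphi measurableT _ mD; rewrite setTI.
have [A mA hA] := h n (fun i => phi @^-1` B i) (fun i => mpre _ (mB i)) S Sfin e e0.
exists A => // i j c Sc; have := hA i j c Sc.
suff -> : P (bernoulli_shift c @` (phi @^-1` B i) `&` phi @^-1` B j) =
  nu (g c @` B i `&` B j) by [].
rewrite shift_image (act_image gP) -phi_nu; last first.
  by apply: measurableI => //; exact: (measurable_act_preimage gP).
apply: probability_ae_eq.
- apply: measurableI; last exact: mpre.
  by apply: measurable_shift_preimage; exact: mpre.
- apply: mpre; apply: measurableI => //.
  exact: (measurable_act_preimage gP).
(* Images under [c] have become preimages under [c^-1], hence equivariance at [c^-1]. *)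
apply: negligibleS (phi_eq c^-1%g) => w hw /= ew; move: hw.
by rewrite /setY /setD /setU /setI /preimage /= ew; tauto.
Qed.

End weak_containment.

Theorem theorem1 (R : realType) (G : groupType)
    (G_countable : countable [set: G]%classic)
    (G_infinite : infinite_set [set: G]%classic) :
  (forall (d : measure_display) (X : measurableType d) (mu : probability X R)
      (f : G -> X -> X),
    pmp_action mu f -> free_action mu f ->
    forall (d' : measure_display) (K : measurableType d')
      (kappa : probability K R) (P : probability (prod_space G K) R),
    standard_borel R K -> product_measure kappa P ->
    weakly_contains mu f P (@bernoulli_shift G K))
  /\
  (forall (d1 : measure_display) (X : measurableType d1)
      (mu : probability X R) (f : G -> X -> X)
      (d2 : measure_display) (Y : measurableType d2)
      (nu : probability Y R) (g : G -> Y -> Y),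
    pmp_action mu f -> free_action mu f -> factor_of_iid mu f ->
    pmp_action nu g -> free_action nu g -> factor_of_iid nu g ->
    weakly_equivalent mu f nu g).
Proof.
split=> [d X mu f fP ffree d' K kappa P _ PK|].
  exact: weakly_contains_bernoulli PK.
move=> d1 X mu f d2 Y nu g fP ffree [d3 [K [kappa [P [_ PK Pf]]]]].
move=> gP gfree [d4 [L [lambda [Q [_ QL Qg]]]]]; split.
(* Each free action weakly contains the Bernoulli shift of which the other action is a factor. *)
- by apply: weakly_contains_factor gP Qg _; exact: weakly_contains_bernoulli QL.
- by apply: weakly_contains_factor fP Pf _; exact: weakly_contains_bernoulli PK.
Qed.
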